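(* Let $p_1, p_2, q$ be real numbers with $1\le p_1\le q<\infty$ and $1\le p_2\le q<\infty$. If $w\ell^{p_2}_q\subseteq w\ell^{p_1}_q$, then $p_1\le p_2$.
   Context: For $m\in\mathbb{Z}$ and $N\in\mathbb{N}_0=\mathbb{N}\cup\{0\}$ let $S_{m,N}:=\{m-N,\ldots,m,\ldots,m+N\}\subset\mathbb{Z}$, so $|S_{m,N}|=2N+1$. For $1\le p\le q<\infty$, the weak type discrete Morrey space $w\ell^p_q$ is the set of all scalar sequences $x=(x_j)_{j\in\mathbb{Z}}$ for which the quasi-norm $$\|x\|_{w\ell^p_q}:=\sup_{m\in\mathbb{Z},\,N\in\mathbb{N}_0,\,\gamma>0}\gamma\,|S_{m,N}|^{\frac1q-\frac1p}\,\big|\{j\in S_{m,N}:|x_j|>\gamma\}\big|^{\frac1p}$$ is finite, where $|A|$ denotes the cardinality of a finite set $A$. *)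

(* Defs.v *)
From HB Require Import structures.
From mathcomp Require Import all_boot all_order all_algebra finmap.
From mathcomp Require Import all_classical all_reals all_analysis.
From mathcomp Require Import complex zify.

Set Implicit Arguments.
Unset Strict Implicit.
Unset Printing Implicit Defensive.

Import Order.TTheory GRing.Theory Num.Theory.

Local Open Scope fset_scope.
Local Open Scope classical_set_scope.
Local Open Scope ring_scope.

(* {m - N, ..., m, ..., m + N}; see mem_window and card_window *)
Definition window (m : int) (N : nat) : {fset int} :=
  [fset (m - N%:Z + k%:Z)%R | k in iota 0 N.*2.+1]%fset.

Lemma mem_window (m : int) (N : nat) (j : int) :
  (j \in window m N) = (m - N%:Z <= j <= m + N%:Z).
Proof.
apply/imfsetP/idP => /= [[k] | /andP[mj jm]].
  by rewrite inE mem_iota => ltk ->; lia.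
exists (absz (j - (m - N%:Z))%R); last by lia.
by rewrite inE mem_iota; lia.
Qed.

Lemma card_window (m : int) (N : nat) : #|` window m N| = N.*2.+1.
Proof.
rewrite card_imfset; last by move=> i j /=; lia.
exact: etrans (congr1 size (undup_id (iota_uniq 0 _))) (size_iota _ _).
Qed.

Section WeakMorrey.
Context {R : realType} {V : normedZmodType R}.

(* V is the scalar field, with its real-valued absolute value: R itself or
   Rcomplex R, the complex numbers with the modulus valued in R (the default
   norm on R[i] is valued in R[i]). *)
Implicit Types (x : int -> V) (p q : R).

Definition level_set x (S : {fset int}) (gamma : R) : {fset int} :=
  [fset j in S | (gamma < `|x j|)%R]%fset.

Definition weak_morrey_norm p q x : \bar R :=
  ereal_sup [set y : \bar R | exists (m : int) (N : nat) (gamma : R),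
    0 < gamma /\
    y = (gamma * #|` window m N|%:R `^ (q^-1 - p^-1)
               * #|` level_set x (window m N) gamma|%:R `^ p^-1)%:E].

End WeakMorrey.

Definition weak_morrey {R : realType} (V : normedZmodType R) (p q : R) :
    set (int -> V) :=
  [set x | (weak_morrey_norm p q x < +oo)%E].
Arguments weak_morrey {R} V p q _.

(* Main.v *)
(* For p2 < p1 put a = q / (q - p2) and E = { floor (k ^ a) : k in N }.  The
   function t |-> t ^ a is superadditive, so E is at least as sparse in any
   window as near 0: a window of size s contains at most 2 s ^ (1/a) points of
   E, while infinitely many windows centered at 0 contain at least a constant
   times s ^ (1/a).  As 1/a = 1 - p2/q, the indicator of E has finite
   w-l^{p2}_q quasi-norm, but these centered windows give values
   of order s ^ ((1 - p2/p1)/q) in the w-l^{p1}_q quasi-norm. *)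
Require Import Defs.
From mathcomp Require Import all_boot all_order all_algebra.
From mathcomp Require Import finmap.
From mathcomp Require Import all_classical all_reals all_analysis.
From mathcomp Require Import complex.
From mathcomp Require Import zify ring lra.

Set Implicit Arguments.
Unset Strict Implicit.

Import Order.TTheory GRing.Theory Num.Theory.
Local Open Scope classical_set_scope.
Local Open Scope ring_scope.

(** Write t ^ a = t * t ^ (a - 1): as a - 1 >= 0, both x ^ (a - 1) and y ^ (a - 1) are at most (x +
    y) ^ (a - 1). *)
Lemma powR_superadditive (R : realType) (a x y : R) :
  1 <= a -> 0 <= x -> 0 <= y -> x `^ a + y `^ a <= (x + y) `^ a.
Proof.
move=> a1 x0 y0; have a0 : 0 < a by lra.
have xy0 : 0 <= x + y by lra.
rewrite -(mulr_powRB1 x0 a0) -(mulr_powRB1 y0 a0) -(mulr_powRB1 xy0 a0) mulrDl.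
by apply: lerD; apply: ler_wpM2l => //; apply: ge0_ler_powR;
   rewrite ?nnegrE; lra.
Qed.

Lemma le_powR_inv (R : realType) (a x y : R) : 0 < a -> 0 <= x ->
  x `^ a <= y -> x <= y `^ a^-1.
Proof.
move=> a0 x0 xy; rewrite -[leLHS](powRr1 x0) -(mulfV (lt0r_neq0 a0)) powRrM.
by apply: ge0_ler_powR; rewrite // ?nnegrE ?invr_ge0 ?(ltW a0) ?powR_ge0//;
   apply: le_trans xy; rewrite powR_ge0.
Qed.

Definition floor_powR (R : realType) (a : R) (k : nat) : nat :=
  Num.truncn (k%:R `^ a).

(** Superadditivity gives (k + 1) ^ a >= k ^ a + 1, a gap that survives truncation. *)
Lemma floor_powR_lt (R : realType) (a : R) : 1 <= a ->
  {homo floor_powR a : k l / (k < l)%N >-> (k < l)%N}.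
Proof.
move=> a1 k l kl; rewrite /floor_powR truncn_ge_nat ?powR_ge0//.
have le_trunc : (Num.truncn (k%:R `^ a))%:R <= k%:R `^ a :> R.
  by rewrite truncn_le powR_ge0.
have := powR_superadditive a1 (ler0n R k) ler01.
rewrite powR1 -(natr1 (Num.truncn _)) => le_S.
suff : (k%:R + 1) `^ a <= l%:R `^ a by lra.
by rewrite natr1; apply: ge0_ler_powR; rewrite ?nnegrE ?ler0n ?ler_nat//; lra.
Qed.

Lemma floor_powR_inj (R : realType) (a : R) : 1 <= a ->
  injective (floor_powR a).
Proof.
move=> a1 k l ekl; case: (ltngtP k l) => // /(floor_powR_lt a1).
  by rewrite ekl ltnn.
by rewrite ekl ltnn.
Qed.

Lemma card_floor_powR_iota (R : realType) (a : R) (m n : nat) : 1 <= a ->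
  #|` [fset (floor_powR a k)%:Z | k in iota m n]%fset| = n.
Proof.
move=> a1; rewrite card_imfset; last by move=> i j [] /(floor_powR_inj a1).
exact: etrans (congr1 size (undup_id (iota_uniq m n))) (size_iota m n).
Qed.

(** Superadditivity on l = (l - k) + k; the + 1 pays for truncating l ^ a. *)
Lemma powR_gap (R : realType) (a : R) (k l : nat) : 1 <= a -> (k <= l)%N ->
  (l - k)%:R `^ a <= (floor_powR a l)%:R - (floor_powR a k)%:R + 1 :> R.
Proof.
move=> a1 kl.
have := powR_superadditive a1 (ler0n R (l - k)) (ler0n R k).
rewrite -natrD subnK // => gap.
have : (floor_powR a k)%:R <= k%:R `^ a :> R by rewrite truncn_le powR_ge0.
have := truncnS_gt (l%:R `^ a : R); rewrite -natr1 -/(floor_powR a l); lra.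
Qed.

Definition sparse_seq (R : realType) (V : normedZmodType R) (v : V) (a : R)
    (j : int) : V :=
  if `[< exists k, j = (floor_powR a k)%:Z >] then v else 0.

(** If [k0] is the least index whose point lies in the window, the gap estimate confines all other
    indices to k0, ..., k0 + n with n the floor of s ^ (1/a). Since s >= 1, n + 1 <= 2 s ^ (1/a). *)
Lemma card_level_set_sparse_le (R : realType) (V : normedZmodType R) (v : V)
    (a gamma : R) (m : int) (N : nat) : 1 <= a -> 0 < gamma ->
  #|` level_set (sparse_seq v a) (window m N) gamma|%:R
    <= 2 * #|` window m N|%:R `^ a^-1 :> R.
Proof.
move=> a1 g0; set L := level_set _ _ _; rewrite card_window.
set s : R := N.*2.+1%:R.
have s1 : 1 <= s by rewrite ler1n.
have a0 : 0 < a^-1 by rewrite invr_gt0; lra.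
have sa1 : 1 <= s `^ a^-1 by rewrite -[leLHS](powRr0 s) ler_powR // ltW.
have inL j : j \in L ->
    j \in window m N /\ exists k, j = (floor_powR a k)%:Z.
  rewrite !inE /= => /andP[jw]; rewrite /sparse_seq.
  by case: asboolP => // _; rewrite normr0 => /(lt_trans g0); rewrite ltxx.
case: (pselect (exists k, (floor_powR a k)%:Z \in window m N)); last first.
  move=> noE; have -> : L = fset0.
    apply/eqP; rewrite -[_ == _]negbK; apply/negP => /fset0Pn[j /inL[jw [k jk]]].
    by apply: noE; exists k; rewrite -jk.
  by rewrite cardfs0; lra.
move=> exE; case: (ex_minnP exE) => k0 k0w k0min.
pose n := Num.truncn (s `^ a^-1).
have subL : (L `<=` [fset (floor_powR a k)%:Z | k in iota k0 n.+1])%fset.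
  apply/fsubsetP => j /inL[jw [k jk]]; apply/imfsetP; exists k => //=.
  rewrite jk in jw; have k0k := k0min _ jw.
  rewrite -[_ \in _]/(k \in iota k0 n.+1) mem_iota k0k addnS ltnS
    -leq_subLR truncn_ge_nat ?powR_ge0//.
  (* Two points of the window differ by at most s - 1, which absorbs the + 1 of [powR_gap]. *)
  have ks : (k - k0)%:R `^ a <= s.
    apply: (le_trans (powR_gap a1 k0k)).
    move: jw k0w; rewrite !mem_window => /andP[jw1 jw2] /andP[kw1 kw2].
    suff : (floor_powR a k)%:R + 1 <= s + (floor_powR a k0)%:R by lra.
    by rewrite natr1 -natrD ler_nat; lia.
  by apply: le_powR_inv => //; lra.
have Ln : (#|` L| <= n.+1)%N.
  by rewrite -(card_floor_powR_iota k0 n.+1 a1) fsubset_leq_card.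
have : #|` L|%:R <= n.+1%:R :> R by rewrite ler_nat.
have : n%:R <= s `^ a^-1 by rewrite truncn_le powR_ge0.
rewrite -(natr1 n); lra.
Qed.

(** The radius is the point of index [k], so the window contains the k + 1 distinct points of
    indices 0, ..., k. *)
Lemma card_level_set_sparse_ge (R : realType) (V : normedZmodType R) (v : V)
    (a gamma : R) (k : nat) : 1 <= a -> gamma < `|v| ->
  (k < #|` level_set (sparse_seq v a) (window 0 (floor_powR a k)) gamma|)%N.
Proof.
move=> a1 gv.
rewrite -[X in (X <= _)%N](card_floor_powR_iota 0 k.+1 a1).
apply/fsubset_leq_card/fsubsetP => j /imfsetP[l /=].
rewrite -[_ \in _]/(l \in iota 0 k.+1) mem_iota leq0n add0n ltnS => lk ->.
rewrite !inE /= mem_window.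
rewrite /sparse_seq asboolT; last by exists l.
rewrite gv andbT.
suff : (floor_powR a l <= floor_powR a k)%N by lia.
by move: lk; rewrite leq_eqVlt => /predU1P[->//|/(floor_powR_lt a1)/ltnW].
Qed.

Lemma sparse_seq_weak_morrey (R : realType) (V : normedZmodType R) (v : V)
    (p q : R) : 0 < p -> p < q ->
  weak_morrey V p q (sparse_seq v (q / (q - p))).
Proof.
move=> p0 pq; set a := q / (q - p).
have a1 : 1 <= a by rewrite ler_pdivlMr; lra.
apply: (@le_lt_trans _ _ (`|v| * 2 `^ p^-1)%:E); last exact: ltry.
apply: ge_ereal_sup => _ [m [N [gamma [g0 ->]]]]; rewrite lee_fin.
set L := level_set _ _ _; set s : R := #|` window m N|%:R.
have s0 : 0 < s by rewrite /s card_window ltr0n.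
have [vg|gv] := leP `|v| gamma.
  have -> : L = fset0.
    apply/eqP; rewrite -[_ == _]negbK; apply/negP => /fset0Pn[j].
    rewrite !inE /= /sparse_seq => /andP[_]; case: asboolP => _.
      by rewrite ltNge vg.
    by rewrite normr0 => /(lt_trans g0); rewrite ltxx.
  rewrite cardfs0 powR0 ?mulr0 ?mulr_ge0 ?powR_ge0//.
  by rewrite invr_eq0 gt_eqF.
have L_le : #|` L|%:R `^ p^-1 <= (2 * s `^ a^-1) `^ p^-1.
  apply: ge0_ler_powR; rewrite ?nnegrE ?invr_ge0 ?ler0n ?mulr_ge0 ?powR_ge0//.
    exact: ltW.
  exact: card_level_set_sparse_le.
have le_s : s `^ (q^-1 - p^-1) * #|` L|%:R `^ p^-1 <= 2 `^ p^-1.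
  apply: (le_trans (ler_wpM2l (powR_ge0 _ _) L_le)).
  rewrite powRM ?powR_ge0 // -powRrM mulrCA -powRD; last first.
    by rewrite (gt_eqF s0) implybT.
  (* This cancellation dictates the choice of [a]: 1/a = 1 - p/q. *)
  have -> : q^-1 - p^-1 + a^-1 / p = 0.
    by rewrite /a; field; rewrite !gt_eqF//; lra.
  by rewrite powRr0 mulr1.
rewrite -mulrA; apply: ler_pM => //; first exact: ltW.
- by rewrite mulr_ge0 ?powR_ge0.
- exact: ltW.
Qed.

Lemma sparse_seq_notin_weak_morrey (R : realType) (V : normedZmodType R)
    (v : V) (p1 p2 q : R) : v != 0 -> 0 < p2 -> p2 < p1 -> p1 <= q ->
  ~ weak_morrey V p1 q (sparse_seq v (q / (q - p2))).
Proof.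
move=> v0 p20 p21 p1q; set a := q / (q - p2); set x := sparse_seq v a.
have a1 : 1 <= a by rewrite ler_pdivlMr; lra.
have nv0 : 0 < `|v| by rewrite normr_gt0.
(* The window size enters with exponent [- b] <= 0, so an upper bound on it bounds the quasi-norm
   from below. With k + 1 points in a window of size at most 3 (k + 1) ^ a, the resulting power of k
   + 1 is [d]; the 3 goes into [C]. *)
pose b := p1^-1 - q^-1.
have b0 : 0 <= b by rewrite subr_ge0 lef_pV2 ?posrE; lra.
pose d := p1^-1 - a * b.
have d0 : 0 < d.
  have -> : d = (p1 - p2) / (p1 * (q - p2)).
    by rewrite /d /b /a; field; rewrite !gt_eqF//; lra.
  by rewrite divr_gt0 ?mulr_gt0 //; lra.
pose C := `|v| / 2 * 3 `^ (- b).
have C0 : 0 < C by rewrite !mulr_gt0 ?powR_gt0//; lra.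
have norm_ge (k : nat) : ((C * k.+1%:R `^ d)%:E <= weak_morrey_norm p1 q x)%E.
  set n : R := k.+1%:R; have n1 : 1 <= n by rewrite ler1n.
  have na1 : 1 <= n `^ a by rewrite -(powRr0 n) ler_powR//; lra.
  pose N := floor_powR a k.
  pose L := level_set x (window 0 N) (`|v| / 2).
  apply: (@le_trans _ _ (`|v| / 2 * #|` window 0 N|%:R `^ (q^-1 - p1^-1)
               * #|` L|%:R `^ p1^-1)%:E); last first.
    by apply: ereal_sup_ubound; exists 0, N, (`|v| / 2); split => //; lra.
  have nL : n <= #|` L|%:R.
    by rewrite ler_nat; apply: card_level_set_sparse_ge => //; lra.
  have Ns : #|` window 0 N|%:R <= 3 * n `^ a.
    rewrite card_window -natr1 -muln2 natrM.
    have : N%:R <= n `^ a.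
      apply: (@le_trans _ _ (k%:R `^ a)); first by rewrite truncn_le powR_ge0.
      by apply: ge0_ler_powR; rewrite ?nnegrE ?ler0n ?ler_nat//; lra.
    lra.
  have -> : q^-1 - p1^-1 = - b by rewrite /b opprB.
  have s_ge : (3 * n `^ a) `^ (- b) <= #|` window 0 N|%:R `^ (- b).
    rewrite !powRN lef_pV2 ?posrE ?powR_gt0 ?card_window ?ltr0n//; last by lra.
    rewrite -(card_window 0 N).
    by apply: ge0_ler_powR; rewrite ?nnegrE ?ler0n//; lra.
  rewrite lee_fin.
  have -> : C * n `^ d = `|v| / 2 * (3 * n `^ a) `^ (- b) * n `^ p1^-1.
    rewrite powRM ?powR_ge0// -powRrM /C -!mulrA -powRD; last first.
      by rewrite (@gt_eqF _ _ n 0) ?implybT//; lra.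
    by congr (_ * (_ * (_ * n `^ _))); rewrite /d /a; ring.
  apply: ler_pM; rewrite ?mulr_ge0 ?powR_ge0//.
    by apply: ler_wpM2l => //; lra.
  by apply: ge0_ler_powR; rewrite ?nnegrE ?invr_ge0 ?ler0n//; lra.
(* A finite value [M] would bound every k + 1 by (M / C) ^ (1/d); the value -oo is excluded by the
   estimate at k = 0. *)
rewrite /weak_morrey /=; case: (weak_morrey_norm p1 q x) norm_ge => // [M|] M_ge _.
  have M_bound k : k.+1%:R <= (M / C) `^ d^-1.
    have nd : k.+1%:R `^ d <= M / C by rewrite ler_pdivlMr// mulrC -lee_fin.
    exact: le_powR_inv.
  have := truncnS_gt ((M / C) `^ d^-1).
  by rewrite ltNge M_bound.
by have := M_ge 0.
Qed.

(** Keeping [V] and a nonzero [v] general lets real and complex scalars both be instances with v =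
    1. *)
Lemma weak_morrey_subset_le (R : realType) (V : normedZmodType R) (v : V)
    (p1 p2 q : R) : v != 0 -> 0 < p2 -> p1 <= q ->
  weak_morrey V p2 q `<=` weak_morrey V p1 q -> p1 <= p2.
Proof.
move=> v0 p20 p1q sub; rewrite leNgt; apply/negP => p21.
apply: (sparse_seq_notin_weak_morrey v0 p20 p21 p1q).
by apply/sub/sparse_seq_weak_morrey; lra.
Qed.

Theorem theorem2p10 (R : realType) (p1 p2 q : R)
    (hp1 : 1 <= p1) (hp1q : p1 <= q) (hp2 : 1 <= p2) (hp2q : p2 <= q) :
  (weak_morrey R p2 q `<=` weak_morrey R p1 q -> p1 <= p2) /\
  (weak_morrey (Rcomplex R) p2 q `<=` weak_morrey (Rcomplex R) p1 q ->
    p1 <= p2).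
Proof.
have p20 : 0 < p2 by lra.
split.
  exact: (@weak_morrey_subset_le _ R 1 _ _ _ (oner_neq0 _)).
exact: (@weak_morrey_subset_le _ (Rcomplex R) 1 _ _ _ (oner_neq0 _)).
Qed.
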